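(* Let $S$ be a finite set, $f:S\to\mathbb{R}$ a nonconstant function, $\Theta\subseteq\mathbb{R}$, and let $(q_\theta,P_\theta)_{\theta\in\Theta}$ be a family of initial distributions $q_\theta$ on $S$ and stochastic matrices $P_\theta$ on $S$ such that (1) $P_\theta$ is irreducible for all $\theta\in\Theta$; (2) $P_\theta(x,y)>0\Rightarrow P_\lambda(x,y)>0$ for all $\theta,\lambda\in\Theta$, $x,y\in S$; (3) $q_\theta(x)>0\Rightarrow q_\lambda(x)>0$ for all $\theta,\lambda\in\Theta$, $x\in S$. Let $\boldsymbol{\theta}=(\theta_1,\dots,\theta_K)\in\boldsymbol{\Theta}$, and for each $\delta\in(0,1)$ let $\mathcal{A}_\delta=((A_t)_{t\ge1},\tau_\delta,\hat a_{\tau_\delta})$ be a $\delta$-PC sampling strategy. Then $$T^*(\boldsymbol{\theta})\le\liminf_{\delta\to0}\frac{\mathbb{E}^{\mathcal{A}_\delta}_{\boldsymbol{\theta}}[\tau_\delta]}{\log\frac1\delta},$$ where $$T^*(\boldsymbol{\theta})^{-1}=\sup_{\boldsymbol{w}\in\mathcal{M}_1([K])}\ \inf_{\boldsymbol{\lambda}\in\mathrm{Alt}(\boldsymbol{\theta})}\ \sum_{a=1}^K w_a\,D(\theta_a\,\Vert\,\lambda_a).$$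
   Context: For $\theta\in\Theta$, $\pi_\theta$ is the unique stationary distribution of $P_\theta$ and $\mu(\theta)=\sum_{x}f(x)\pi_\theta(x)$. There are $K$ arms, $[K]=\{1,\dots,K\}$. For $\boldsymbol{\theta}\in\Theta^K$, arm $a$ carries a Markov chain $(X_n^a)_{n\ge0}$ on $S$ with initial distribution $q_{\theta_a}$ and transition matrix $P_{\theta_a}$, the $K$ chains being independent; the reward process of arm $a$ is $Y_n^a=f(X_n^a)$, and only rewards are observed. $\boldsymbol{\Theta}$ is the set of $\boldsymbol{\theta}\in\Theta^K$ for which $\arg\max_{a\in[K]}\mu(\theta_a)$ is a singleton, and then $a^*(\boldsymbol{\theta})$ denotes the unique maximizer. $\mathrm{Alt}(\boldsymbol{\theta})=\{\boldsymbol{\lambda}\in\boldsymbol{\Theta}:a^*(\boldsymbol{\lambda})\ne a^*(\boldsymbol{\theta})\}$. $\mathcal{M}_1([K])$ is the set of probability distributions on $[K]$. Kullback-Leibler divergence rate: $D(\theta\,\Vert\,\lambda)=\sum_{x,y\in S}\pi_\theta(x)P_\theta(x,y)\log\frac{P_\theta(x,y)}{P_\lambda(x,y)}$, with terms with $P_\theta(x,y)=0$ equal to $0$. Sampling: at each time $t=1,2,\dots$ one arm $A_t$ is selected and the next (not yet observed) sample of the reward process of arm $A_t$ is observed (the first observation from arm $a$ is $Y_0^a$, the second $Y_1^a$, etc.), while the other arms stay still. $\mathcal{F}_t$ is the $\sigma$-field generated by $A_1,\dots,A_t$ and the rewards observed up to time $t$. A sampling strategy $\mathcal{A}_\delta=((A_t)_{t\ge1},\tau_\delta,\hat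 a_{\tau_\delta})$ consists of a sampling rule with $A_{t+1}$ being $\mathcal{F}_t$-measurable; a stopping time $\tau_\delta$ with respect to $(\mathcal{F}_t)_{t\ge1}$ with $\mathbb{E}_{\boldsymbol{\lambda}}^{\mathcal{A}_\delta}[\tau_\delta]<\infty$ for all $\boldsymbol{\lambda}\in\boldsymbol{\Theta}$; and an $\mathcal{F}_{\tau_\delta}$-measurable decision $\hat a_{\tau_\delta}\in[K]$. $\mathbb{P}_{\boldsymbol{\lambda}}^{\mathcal{A}_\delta},\mathbb{E}_{\boldsymbol{\lambda}}^{\mathcal{A}_\delta}$ denote probability and expectation when the arms have parameters $\boldsymbol{\lambda}$ and the strategy $\mathcal{A}_\delta$ is used. The strategy is $\delta$-PC if $\mathbb{P}_{\boldsymbol{\lambda}}^{\mathcal{A}_\delta}(\hat a_{\tau_\delta}\ne a^*(\boldsymbol{\lambda}))\le\delta$ for all $\boldsymbol{\lambda}\in\boldsymbol{\Theta}$. Conventions: $1/0=\infty$, $1/\infty=0$, the infimum over the empty set is $\infty$. *)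

(* Defs.v *)
From mathcomp Require Import all_boot all_order all_algebra.
From mathcomp Require Import all_classical all_reals all_analysis.
Set Implicit Arguments.
Unset Strict Implicit.
Unset Printing Implicit Defensive.
Import Order.TTheory GRing.Theory Num.Theory.
Import numFieldNormedType.Exports.
Local Open Scope classical_set_scope.
Local Open Scope ring_scope.

Section FiniteChains.
Variables (R : realType) (S : finType).

Definition is_distr (p : S -> R) : Prop :=
  (forall x, 0 <= p x) /\ \sum_x p x = 1.

Definition is_stochastic (P : S -> S -> R) : Prop :=
  forall x, is_distr (P x).

Fixpoint nstep (P : S -> S -> R) (n : nat) (x y : S) : R :=
  if n is m.+1 then \sum_z P x z * nstep P m z y else (x == y)%:R.

Definition irreducible (P : S -> S -> R) : Prop :=
  forall x y, exists n, 0 < nstep P n x y.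

Definition is_stationary (P : S -> S -> R) (p : S -> R) : Prop :=
  is_distr p /\ forall y, \sum_x p x * P x y = p y.

(* A total function by classical choice: for an irreducible stochastic matrix
   exactly one distribution satisfies [is_stationary P], and this is it. *)
Definition stationary (P : S -> S -> R) : S -> R :=
  xget (fun=> 0) [set p | is_stationary P p].

Definition stationary_mean (f : S -> R) (P : S -> S -> R) : R :=
  \sum_x f x * stationary P x.

(* Terms with [P x y = 0] vanish because of the factor [P x y]; the divergence
   is only used when the support of [P] is contained in that of [Q]. *)
Definition KL_rate (P Q : S -> S -> R) : R :=
  \sum_x \sum_y stationary P x * P x y * ln (P x y / Q x y).

End FiniteChains.

Section BestArm.
Variables (R : realType) (S : finType) (f : S -> R) (Theta : set R).
Variables (P : R -> S -> S -> R) (K : nat).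

Definition mean_reward (t : R) : R := stationary_mean f (P t).

Definition is_best (l : 'I_K -> R) (a : 'I_K) : bool :=
  [forall b, mean_reward (l b) <= mean_reward (l a)].

Definition bold_Theta : set ('I_K -> R) :=
  [set l | (forall a, Theta (l a)) /\ #|[pred a | is_best l a]| = 1%N].

(* [Some] of the unique maximizer on [bold_Theta]; the option type only avoids
   a default arm when [K = 0]. *)
Definition best_arm (l : 'I_K -> R) : option 'I_K := [pick a | is_best l a].

Definition Alt (t : 'I_K -> R) : set ('I_K -> R) :=
  [set l | bold_Theta l /\ best_arm l <> best_arm t].

Local Open Scope ereal_scope.

(* In the extended reals of the library, [0^-1 = +oo], [+oo^-1 = 0] and
   [ereal_inf set0 = +oo]. *)
Definition characteristic_time (t : 'I_K -> R) : \bar R :=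
  (ereal_sup [set ereal_inf
     [set (\sum_a w a * KL_rate (P (t a)) (P (l a)))%R%:E | l in Alt t]
   | w in [set w : 'I_K -> R | is_distr w]])^-1.

End BestArm.

Section BanditModel.
Variables (R : realType) (S : finType) (K : nat).
Variables (d : measure_display) (Omega : measurableType d).
Implicit Types (Pr : probability Omega R) (X : 'I_K -> nat -> Omega -> S).

Definition is_markov_chain Pr (Z : nat -> Omega -> S)
    (q : S -> R) (P : S -> S -> R) : Prop :=
  (forall x, Pr [set w | Z 0%N w = x] = (q x)%:E) /\
  (forall (n : nat) (x : nat -> S),
     Pr [set w | forall i, (i <= n.+1)%N -> Z i w = x i] =
     (Pr [set w | forall i, (i <= n)%N -> Z i w = x i] *
      (P (x n) (x n.+1))%:E)%E).

Definition sigma_process (Z : nat -> Omega -> S) : set_system Omega :=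
  <<s [set E | exists n x, E = [set w | Z n w = x]] >>.

(* Since [Omega] belongs to every sigma-field, the product rule over all of
   ['I_K] contains the product rule over every subfamily. *)
Definition mutually_independent Pr (G : 'I_K -> set_system Omega) : Prop :=
  forall B : 'I_K -> set Omega, (forall a, G a (B a)) ->
    Pr (\bigcap_a B a) = (\prod_a Pr (B a))%E.

Definition bandit_law Pr X (q : R -> S -> R) (P : R -> S -> S -> R)
    (l : 'I_K -> R) : Prop :=
  (forall a, is_markov_chain Pr (X a) (q (l a)) (P (l a))) /\
  mutually_independent Pr (fun a => sigma_process (X a)).

End BanditModel.

(* Arms are selected at times 1, 2, ...; the value [arm _ 0] is never used.
   [stop s w = None] means that the stopping time is infinite at [w]. *)
Record strategy (K : nat) (Omega : Type) := Strategy {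
  arm : nat -> Omega -> 'I_K;
  stop : Omega -> option nat;
  decision : Omega -> 'I_K }.

Section Strategies.
Variables (R : realType) (S : finType) (f : S -> R) (Theta : set R).
Variables (P : R -> S -> S -> R) (K : nat).
Variables (d : measure_display) (Omega : measurableType d).
Variable X : 'I_K -> nat -> Omega -> S.
Variable Pr : ('I_K -> R) -> probability Omega R.
Implicit Types (A : nat -> Omega -> 'I_K) (s : strategy K Omega).

Definition npulls A (a : 'I_K) (t : nat) (w : Omega) : nat :=
  \sum_(1 <= r < t.+1) (A r w == a).

(* The reward observed at time [t >= 1]: arm [A t w] has then been pulled
   [npulls] times, this pull included, and its chain is indexed from 0. *)
Definition observed A (t : nat) (w : Omega) : R :=
  f (X (A t w) (npulls A (A t w) t w).-1 w).

(* [filtration A 0] is the trivial sigma-field. *)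
Definition filtration A (t : nat) : set_system Omega :=
  <<s [set E | exists r, (1 <= r <= t)%N /\
         ((exists B : set 'I_K, E = A r @^-1` B) \/
          (exists2 B : set R, measurable B & E = observed A r @^-1` B))] >>.

Definition stopped_by (tau : Omega -> option nat) (t : nat) : set Omega :=
  [set w | exists2 r, tau w = Some r & (r <= t)%N].

Definition is_stopping_time A (tau : Omega -> option nat) : Prop :=
  (forall w, tau w <> Some 0%N) /\
  (forall t, (1 <= t)%N -> filtration A t (stopped_by tau t)).

Definition stopped_sigma A (tau : Omega -> option nat) : set_system Omega :=
  [set E | measurable E /\
     forall t, (1 <= t)%N -> filtration A t (E `&` stopped_by tau t)].

Definition time_value (t : option nat) : \bar R :=
  if t is Some n then n%:R%:E else +oo%E.

Definition expected_time (l : 'I_K -> R) s : \bar R :=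
  \int[Pr l]_w time_value (stop s w).

Definition sampling_strategy s : Prop :=
  [/\ (forall t (a : 'I_K),
         filtration (arm s) t [set w | arm s t.+1 w = a]),
      is_stopping_time (arm s) (stop s),
      (forall l, bold_Theta f Theta P l -> (expected_time l s < +oo)%E)
    & (forall a : 'I_K,
         stopped_sigma (arm s) (stop s) [set w | decision s w = a])].

Definition delta_PC (delta : R) s : Prop :=
  forall l, bold_Theta f Theta P l ->
    (Pr l [set w | Some (decision s w) <> best_arm f P l] <= delta%:E)%E.

End Strategies.

(* Main.v *)
Require Import Defs.
From mathcomp Require Import all_boot all_order all_algebra.
From mathcomp Require Import all_classical all_reals all_analysis.
From mathcomp Require Import measurable_realfun ring lra.
Set Implicit Arguments.
Unset Strict Implicit.
Unset Printing Implicit Defensive.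
Import Order.TTheory GRing.Theory Num.Theory.
Import numFieldNormedType.Exports.
Local Open Scope classical_set_scope.
Local Open Scope ring_scope.

(** A strategy that separates [theta] from an alternative [l] with error [delta]
    must collect enough information to tell the two laws apart, and information
    is collected from arm [a] at the rate [KL_rate (P (theta a)) (P (l a))].

    The arm pulled next is a function of the states already seen, so the list of
    pairs (arm, state) observed so far is a finite-valued process, and its law is
    a product of one-step kernels ([has_history_cons]).  Everything that happens
    before [tau /\ n] can therefore be computed on a finite tree, by the recursion
    [stopped_value], and only the comparisons [stopped_prob], [stopped_duration]
    and [sum_survival_le] return to the probability space.

    Two estimates of the expected log-likelihood ratio at [tau /\ n] are compared.
    From below ([stopped_entropy_bound]), the Donsker-Varadhan inequality for the
    function [ln (1 / delta)] times the indicator of the event that the strategy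
    has stopped and recommends the best arm of [theta]: this event has probability
    at least [1 - 2 * delta] under [theta], if [n] is large, and at most [delta]
    under [l], whence the bound [(1 - 2 * delta) * ln (1 / delta) - ln 2].
    From above ([expected_log_ratio_le]), a solution of the Poisson equation of
    each chain turns the sum of the log-ratios along an arm into its number of
    pulls times the divergence rate, plus the increments of a bounded potential.
    With [T] the expectation of [tau /\ n] and [w a] the proportion of it spent on
    arm [a], this gives, with a constant [C l] that does not depend on [delta],
      [(1 - 2 * delta) * ln (1 / delta) - C l
         <= T * \sum_a w a * KL_rate (P (theta a)) (P (l a))],
    which is [finite_horizon_bound].

    The constant [C l] need not be bounded in [l], so the infimum over the
    alternatives cannot be taken for a fixed [delta].  Instead, if the lower limit
    of the theorem is below [c], then a sequence of levels tending to 0 has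
    [T < c * ln (1 / delta)]; the simplex being compact ([limit_allocation]), the
    allocations [w] accumulate at some [w0], for which the weighted divergence is
    at least [1 / c] for every alternative simultaneously.  Hence the
    characteristic time is at most [c]. *)

(** * Stationary distributions and the Poisson equation *)

Section StationaryAndPoisson.
Variables (R : realType) (S : finType) (P : S -> S -> R).
Hypothesis P_stochastic : is_stochastic P.
Hypothesis P_irreducible : irreducible P.

Lemma nstep_stochastic n : is_stochastic (nstep P n).
Proof.
elim: n => [|n IHn] x /=; split.
- by move=> y; case: (x == y).
- by rewrite (bigD1 x) //= eqxx big1 ?addr0 // => y; rewrite eq_sym => /negPf ->.
- by move=> y; apply: sumr_ge0 => z _; rewrite mulr_ge0 ?(P_stochastic x).1 ?(IHn z).1.
- rewrite exchange_big /= -[RHS](P_stochastic x).2; apply: eq_bigr => z _.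
  by rewrite -mulr_sumr (IHn z).2 mulr1.
Qed.

Lemma nstep_harmonic (h : S -> R) (hh : forall x, h x = \sum_y P x y * h y) n x :
  h x = \sum_y nstep P n x y * h y.
Proof.
elim: n x => [|n IHn] x /=.
  rewrite (bigD1 x) //= eqxx mul1r big1 ?addr0 // => y.
  by rewrite eq_sym => /negPf ->; rewrite mul0r.
under [RHS]eq_bigr => y _ do rewrite mulr_suml.
rewrite exchange_big /= [LHS]hh; apply: eq_bigr => z _.
by rewrite IHn mulr_sumr; apply: eq_bigr => y _; rewrite mulrA.
Qed.

(** Maximum principle: if [h] attains its maximum at [m], then [h m] is an
    average of the values of [h] over the states that are reachable from [m] in
    [n] steps, so all of these are maximal too. *)
Lemma harmonic_constant (h : S -> R) :
  (forall x, h x = \sum_y P x y * h y) -> forall x y, h x = h y.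
Proof.
move=> hh x0.
pose m := [arg max_(i > x0) h i]%O.
have hm z : h z <= h m by rewrite /m; case: arg_maxP => // i _; exact.
suff hc z : h z = h m by move=> y; rewrite !hc.
have [n nmz] := P_irreducible m z.
have : \sum_y nstep P n m y * (h m - h y) = 0.
  under eq_bigr => y _ do rewrite mulrBr.
  by rewrite sumrB -mulr_suml (nstep_stochastic n m).2 mul1r -nstep_harmonic // subrr.
move/eqP; rewrite psumr_eq0 => [|y _]; last first.
  by rewrite mulr_ge0 ?subr_ge0 ?(nstep_stochastic n m).1.
move=> /allP /(_ z (mem_index_enum _)) /=.
by rewrite mulf_eq0 (gt_eqF nmz) subr_eq0 => /eqP ->.
Qed.

(** The matrix of [1 - P]: its left kernel consists of the invariant row vectors,
    its right kernel of the harmonic functions. *)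
Let generator : 'M[R]_#|S| :=
  \matrix_(i, j) ((i == j)%:R - P (enum_val i) (enum_val j)).

Let sum_enum_val (F : S -> R) : \sum_(i < #|S|) F (enum_val i) = \sum_x F x.
Proof. by rewrite [RHS](reindex _ (onW_bij _ (@enum_val_bij S))). Qed.

Let generator_row (u : 'rV[R]_#|S|) y :
  (u *m generator) 0 (enum_rank y) =
  u 0 (enum_rank y) - \sum_x u 0 (enum_rank x) * P x y.
Proof.
rewrite mxE; under eq_bigr => i _ do rewrite mxE mulrBr.
rewrite sumrB; congr (_ - _).
  rewrite (bigD1 (enum_rank y)) //= eqxx mulr1 big1 ?addr0 // => i /negPf ->.
  by rewrite mulr0.
rewrite -sum_enum_val; apply: eq_bigr => i _.
by rewrite enum_valK enum_rankK.
Qed.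

Let generator_col (u : 'rV[R]_#|S|) x :
  (u *m generator^T) 0 (enum_rank x) =
  u 0 (enum_rank x) - \sum_y P x y * u 0 (enum_rank y).
Proof.
rewrite mxE; under eq_bigr => i _ do rewrite !mxE mulrBr.
rewrite sumrB; congr (_ - _).
  rewrite (bigD1 (enum_rank x)) //= eqxx mulr1 big1 ?addr0 // => i.
  by rewrite eq_sym => /negPf ->; rewrite mulr0.
rewrite -sum_enum_val; apply: eq_bigr => i _.
by rewrite enum_valK enum_rankK mulrC.
Qed.

Let row_eqP (u v : 'rV[R]_#|S|) :
  (forall x, u 0 (enum_rank x) = v 0 (enum_rank x)) -> u = v.
Proof. by move=> uv; apply/rowP => i; rewrite -(enum_valK i) uv. Qed.

(** [1 - P] kills the constants, so it is singular and some nonzero row vector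
    [v] is invariant.  Then [`|v|] is dominated by its image under [P]; as both
    have the same total mass, it is invariant too, and only needs normalizing. *)
Lemma stationary_exists (x0 : S) : exists p, is_stationary P p.
Proof.
have : kermx generator != 0.
  rewrite kermx_eq0 row_free_unit; apply/negP => gU.
  have g1 : generator *m const_mx 1 = 0 :> 'cV_#|S|.
    apply: trmx_inj; rewrite trmx_mul trmx0 trmx_const; apply: row_eqP => x.
    rewrite generator_col !mxE; under eq_bigr do rewrite mxE mulr1.
    by rewrite (P_stochastic x).2 subrr.
  have : (const_mx 1 : 'cV[R]_#|S|) = 0 by rewrite -(mulKmx gU (const_mx 1)) g1 mulmx0.
  by move/matrixP/(_ (enum_rank x0) 0)/eqP; rewrite !mxE oner_eq0.
move=> /rowV0Pn [u /sub_kermxP uG u0].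
pose v x := u 0 (enum_rank x).
have vP y : v y = \sum_x v x * P x y.
  by apply/eqP; rewrite -subr_eq0 -generator_row uG mxE.
have le_abs y : `|v y| <= \sum_x `|v x| * P x y.
  rewrite [v y]vP; apply: le_trans (ler_norm_sum _ _ _) _.
  by apply: ler_sum => x _; rewrite normrM (ger0_norm ((P_stochastic x).1 y)).
have sum_abs : \sum_y (\sum_x `|v x| * P x y - `|v y|) = 0.
  rewrite sumrB exchange_big /=; under eq_bigr => x _ do
    rewrite -mulr_sumr (P_stochastic x).2 mulr1.
  by rewrite subrr.
have abs_inv y : \sum_x `|v x| * P x y = `|v y|.
  move/eqP: sum_abs; rewrite psumr_eq0 => [|z _]; last by rewrite subr_ge0.
  by move=> /allP /(_ y (mem_index_enum _)) /=; rewrite subr_eq0 => /eqP.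
have mass_gt0 : 0 < \sum_x `|v x|.
  rewrite lt_def sumr_ge0 // andbT psumr_eq0 //; apply: contra u0 => /allP v0.
  apply/eqP/row_eqP => x; apply/eqP; rewrite mxE -normr_eq0.
  exact: (v0 x (mem_index_enum _)).
exists (fun x => `|v x| / \sum_x `|v x|); split; first split.
- by move=> x; rewrite divr_ge0 // ltW.
- by rewrite -mulr_suml mulfV // gt_eqF.
- move=> y; under eq_bigr => x _ do rewrite mulrAC.
  by rewrite -mulr_suml abs_inv.
Qed.

Lemma stationaryP (x0 : S) : is_stationary P (stationary P).
Proof. exact: (@xgetPex _ (fun=> 0) [set p | is_stationary P p] (stationary_exists x0)). Qed.

(** Fredholm alternative: [g] is in the image of [1 - P] as soon as it is
    orthogonal to the left kernel.  By the maximum principle the right kernel is a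
    line, so the left kernel is the line of the stationary distribution. *)
Lemma poisson_equation (x0 : S) (g : S -> R) :
  \sum_x stationary P x * g x = 0 ->
  exists h : S -> R, forall x, h x - \sum_y P x y * h y = g x.
Proof.
move=> pig.
have [[pi_ge0 pi1] piP] := stationaryP x0.
pose p : 'rV[R]_#|S| := \row_i stationary P (enum_val i).
have pE x : p 0 (enum_rank x) = stationary P x by rewrite mxE enum_rankK.
have p_neq0 : p != 0.
  apply/eqP => p0; move: pi1; rewrite big1 => [/eqP|x _].
    by rewrite eq_sym oner_eq0.
  by rewrite -pE p0 mxE.
have p_ker : (p <= kermx generator)%MS.
  apply/sub_kermxP; apply: row_eqP => y; rewrite generator_row pE [RHS]mxE.
  by under eq_bigr => x _ do rewrite pE; rewrite piP subrr.
have ker_const : (kermx generator^T <= (const_mx 1 : 'rV[R]_#|S|))%MS.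
  apply/rV_subP => u /sub_kermxP uG.
  suff -> : u = u 0 (enum_rank x0) *: const_mx 1 by exact: scalemx_sub.
  apply: row_eqP => x; rewrite !mxE mulr1.
  apply: (harmonic_constant (h := fun x => u 0 (enum_rank x))) => {}x.
  by apply/eqP; rewrite -subr_eq0 -generator_col uG mxE.
have ker_p : (kermx generator <= p)%MS.
  rewrite -(mxrank_leqif_sup p_ker) eqn_leq mxrankS //= rank_rV p_neq0.
  rewrite mxrank_ker -mxrank_tr -mxrank_ker.
  by rewrite (leq_trans (mxrankS ker_const)) // rank_leq_row.
have /submxP [D DE] : ((\row_i g (enum_val i) : 'rV[R]_#|S|) <= generator^T)%MS.
  rewrite submxE; set C := cokermx _.
  have /submxP [E CE] : (C^T <= p)%MS.
    apply: submx_trans ker_p; apply/sub_kermxP.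
    by apply: trmx_inj; rewrite trmx_mul trmxK mulmx_coker trmx0.
  rewrite -[C]trmxK CE trmx_mul mulmxA.
  suff -> : (\row_i g (enum_val i)) *m p^T = 0 by rewrite mul0mx.
  apply/matrixP => i j; rewrite !mxE -[RHS]pig -sum_enum_val.
  by apply: eq_bigr => k _; rewrite !mxE mulrC.
exists (fun x => D 0 (enum_rank x)) => x.
by rewrite -generator_col -DE mxE enum_rankK.
Qed.

End StationaryAndPoisson.

(** * Expectations at a bounded stopping time on a tree *)

Section StoppedValues.
Variables (R : realType) (Z : finType) (stopped : seq Z -> bool).
Implicit Types (k c g : seq Z -> R) (kappa : seq Z -> Z -> R) (h : seq Z).

Definition is_kernel kappa := forall h, is_distr (kappa h).

(** Histories are listed with the newest observation first.  This is the
    expectation, for the process with transition kernel [kappa] started from the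
    history [h], of the costs [c] of the histories visited strictly before
    stopping, plus the value of [g] at the history where the process is halted;
    it is halted after [n] steps at the latest. *)
Fixpoint stopped_value kappa c g n h : R :=
  if stopped h then g h
  else if n is m.+1 then
    c h + \sum_z kappa h z * stopped_value kappa c g m (z :: h)
  else g h.

Fixpoint log_ratio kappa kappa' h : R :=
  if h is z :: h' then
    log_ratio kappa kappa' h' + ln (kappa h' z / kappa' h' z)
  else 0.

Definition step_divergence kappa kappa' h : R :=
  \sum_z kappa h z * ln (kappa h z / kappa' h z).

Lemma stopped_value_lin kappa a c g c' g' n h :
  stopped_value kappa (fun h => c h + a * c' h) (fun h => g h + a * g' h) n h =
  stopped_value kappa c g n h + a * stopped_value kappa c' g' n h.
Proof.
elim: n h => [|n IHn] h /=; first by case: ifP.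
case: ifP => // _; under eq_bigr do rewrite IHn mulrDr.
rewrite big_split /= mulrDr mulr_sumr -!addrA; congr (_ + _).
rewrite addrCA; congr (_ + (_ + _)); apply: eq_bigr => z _; ring.
Qed.

Lemma stopped_value_lin_cost kappa a c c' n h :
  stopped_value kappa (fun h => c h + a * c' h) (fun=> 0) n h =
  stopped_value kappa c (fun=> 0) n h + a * stopped_value kappa c' (fun=> 0) n h.
Proof.
rewrite -stopped_value_lin; congr (stopped_value _ _ _ _ _).
by apply/funext => h'; rewrite mulr0 addr0.
Qed.

Lemma stopped_value_lin_end kappa a g g' n h :
  stopped_value kappa (fun=> 0) (fun h => g h + a * g' h) n h =
  stopped_value kappa (fun=> 0) g n h + a * stopped_value kappa (fun=> 0) g' n h.
Proof.
rewrite -stopped_value_lin; congr (stopped_value _ _ _ _ _).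
by apply/funext => h'; rewrite mulr0 addr0.
Qed.

Lemma stopped_value_split kappa c g n h :
  stopped_value kappa c g n h =
  stopped_value kappa c (fun=> 0) n h + stopped_value kappa (fun=> 0) g n h.
Proof.
rewrite -[X in _ + X]mul1r -stopped_value_lin.
by congr (stopped_value _ _ _ _ _); apply/funext => h'; rewrite ?mulr0 ?addr0 // mul1r add0r.
Qed.

Lemma stopped_value_cost_sum kappa (I : finType) (D : I -> R) (c : I -> seq Z -> R) n h :
  stopped_value kappa (fun h => \sum_i D i * c i h) (fun=> 0) n h =
  \sum_i D i * stopped_value kappa (c i) (fun=> 0) n h.
Proof.
elim: n h => [|n IHn] h /=.
  by rewrite if_same big1 // => i _; rewrite mulr0.
case: ifP => _; first by rewrite big1 // => i _; rewrite mulr0.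
under [RHS]eq_bigr => i _ do rewrite mulrDr.
rewrite big_split /=; congr (_ + _).
under eq_bigr => z _ do rewrite IHn mulr_sumr.
rewrite exchange_big; apply: eq_bigr => i _; rewrite mulr_sumr.
by apply: eq_bigr => z _; ring.
Qed.

Lemma le_stopped_value kappa c g g' n h : is_kernel kappa ->
  (forall h, g h <= g' h) ->
  stopped_value kappa c g n h <= stopped_value kappa c g' n h.
Proof.
move=> kP gg'; elim: n h => [|n IHn] h /=; first by rewrite !if_same.
case: ifP => // _; rewrite lerD2l; apply: ler_sum => z _.
by rewrite ler_wpM2l ?(kP h).1.
Qed.

Lemma stopped_value_ge0 kappa c n h : is_kernel kappa ->
  (forall h, 0 <= c h) -> 0 <= stopped_value kappa c (fun=> 0) n h.
Proof.
move=> kP c0; elim: n h => [|n IHn] h /=; first by rewrite if_same.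
case: ifP => // _; rewrite addr_ge0 // sumr_ge0 // => z _.
by rewrite mulr_ge0 ?(kP h).1.
Qed.

(** Dynkin's formula in the case where [g] decreases on average exactly by the
    running cost. *)
Lemma dynkin kappa c g n h :
  (forall h, c h + \sum_z kappa h z * g (z :: h) = g h) ->
  stopped_value kappa c g n h = g h.
Proof.
move=> cg; elim: n h => [|n IHn] h /=; first by rewrite if_same.
by case: ifP => // _; under eq_bigr do rewrite IHn.
Qed.

Lemma stopped_value_cst kappa a n h : is_kernel kappa ->
  stopped_value kappa (fun=> 0) (fun=> a) n h = a.
Proof.
move=> kP; rewrite (@dynkin _ _ (fun=> a)) // => h'.
by rewrite add0r -mulr_suml (kP h').2 mul1r.
Qed.

Section ChangeOfMeasure.
Variables kappa kappa' : seq Z -> Z -> R.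
Hypotheses (kappa_kernel : is_kernel kappa) (kappa'_kernel : is_kernel kappa').
Hypothesis same_support : forall h z, (0 < kappa h z) = (0 < kappa' h z).

Lemma kernel_exp_log_ratio h z :
  kappa h z * expR (- ln (kappa h z / kappa' h z)) = kappa' h z.
Proof.
have [k0|] := boolP (0 < kappa h z); last first.
  move=> kN; have := kN; rewrite same_support.
  rewrite !lt_neqAle !(kappa_kernel h).1 !(kappa'_kernel h).1 !andbT !negbK in kN *.
  by move=> /eqP <-; move/eqP: kN => <-; rewrite mul0r.
have k'0 : 0 < kappa' h z by rewrite -same_support.
rewrite expRN lnK ?posrE ?divr_gt0 // invf_div mulrCA divff ?mulr1 //.
by rewrite gt_eqF.
Qed.

(** At each step the factor [expR (- ln _)] exchanges the two kernels; on stopped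
    histories the ratio stops evolving, as the recursion does. *)
Lemma change_of_measure g n h :
  stopped_value kappa (fun=> 0)
    (fun h => expR (- log_ratio kappa kappa' h) * g h) n h =
  expR (- log_ratio kappa kappa' h) * stopped_value kappa' (fun=> 0) g n h.
Proof.
elim: n h => [|n IHn] h /=; first by rewrite !if_same.
case: ifP => // _; rewrite !add0r mulr_sumr; apply: eq_bigr => z _.
by rewrite IHn /= opprD expRD -[in RHS]kernel_exp_log_ratio; ring.
Qed.

Lemma stopped_log_ratio n :
  stopped_value kappa (fun=> 0) (log_ratio kappa kappa') n [::] =
  stopped_value kappa (step_divergence kappa kappa') (fun=> 0) n [::].
Proof.
have := @dynkin kappa (fun h => 0 + -1 * step_divergence kappa kappa' h)
  (log_ratio kappa kappa') n [::].
rewrite stopped_value_split stopped_value_lin_cost stopped_value_cst //.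
move=> dyn; apply/eqP; rewrite -subr_eq0; apply/eqP.
rewrite -[RHS]/(log_ratio kappa kappa' [::]) -dyn => [|h]; first ring.
rewrite /=; under eq_bigr do rewrite mulrDr.
by rewrite big_split /= -mulr_suml (kappa_kernel h).2 /step_divergence; ring.
Qed.

(** Donsker-Varadhan inequality for the function [b] times the indicator of [e],
    at the stopping time: its exponential moment under [kappa'] is at most 2 by
    assumption, and Jensen's inequality, in the tangent form
    [x <= ln 2 - 1 + expR x / 2], bounds the mean under [kappa] of [b] times the
    indicator minus the log-likelihood ratio by [ln 2]. *)
Lemma stopped_entropy_bound (e : pred (seq Z)) b n : 0 <= b ->
  expR b * stopped_value kappa' (fun=> 0) (fun h => (e h)%:R) n [::] <= 1 ->
  b * stopped_value kappa (fun=> 0) (fun h => (e h)%:R) n [::] - ln 2 <=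
  stopped_value kappa (step_divergence kappa kappa') (fun=> 0) n [::].
Proof.
move=> b0 small.
have expR_bound (x : R) : x <= ln 2 - 1 + 2^-1 * expR x.
  have := expR_ge1Dx (x - ln 2); rewrite expRD expRN lnK ?posrE //; lra.
pose L := log_ratio kappa kappa'.
have step : stopped_value kappa (fun=> 0)
      (fun h => b * (e h)%:R + -1 * L h) n [::] <=
    stopped_value kappa (fun=> 0) (fun h => (ln 2 - 1) + 2^-1 *
      (expR (- L h) * (1 + expR b * (e h)%:R))) n [::].
  apply: le_stopped_value => // h; apply: le_trans (expR_bound _) _.
  rewrite lerD2l ler_pM2l ?invr_gt0 // addrC mulN1r expRD ler_pM2l ?expR_gt0 //.
  by case: (e h); rewrite ?mulr1 ?mulr0 ?expR0 ?addr0 // lerDr.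
have scale : stopped_value kappa (fun=> 0) (fun h => b * (e h)%:R) n [::] =
    b * stopped_value kappa (fun=> 0) (fun h => (e h)%:R) n [::].
  rewrite -[RHS]add0r -[X in X + _](stopped_value_cst 0 n [::] kappa_kernel).
  rewrite -stopped_value_lin_end; congr (stopped_value _ _ _ _ _).
  by apply/funext => h; rewrite add0r.
move: step; rewrite !stopped_value_lin_end stopped_value_cst // change_of_measure /=.
rewrite stopped_value_lin_end stopped_value_cst // oppr0 expR0 mul1r.
rewrite stopped_log_ratio scale; set v := stopped_value kappa' _ _ _ _ in small *.
lra.
Qed.

End ChangeOfMeasure.
End StoppedValues.

(** * The tree of histories of Markovian arms *)

Section ArmHistories.
Variables (R : realType) (S : finType) (K : nat).
Implicit Types (h : seq ('I_K * S)) (z : 'I_K * S) (s : seq S).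

Definition arm_states h (a : 'I_K) : seq S := [seq z.2 | z <- h & z.1 == a].

(** The law of the next state of a chain whose past states are [s]. *)
Definition next_prob (q : S -> R) (P : S -> S -> R) s x : R :=
  if s is y :: _ then P y x else q x.

Definition history_kernel (q : 'I_K -> S -> R) (P : 'I_K -> S -> S -> R)
    (rule : seq ('I_K * S) -> 'I_K) h z : R :=
  (z.1 == rule h)%:R * next_prob (q z.1) (P z.1) (arm_states h z.1) z.2.

Lemma next_prob_distr q P s :
  is_distr q -> is_stochastic P -> is_distr (next_prob q P s).
Proof. by case: s => [|y s] // _; apply. Qed.

Lemma arm_states_cons a x h b :
  arm_states ((a, x) :: h) b =
  if a == b then x :: arm_states h b else arm_states h b.
Proof. by rewrite /arm_states /=; case: ifP. Qed.

Section Kernel.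
Variables (q : 'I_K -> S -> R) (P : 'I_K -> S -> S -> R).
Variable rule : seq ('I_K * S) -> 'I_K.

Lemma history_kernel_sum h (G : 'I_K * S -> R) :
  \sum_z history_kernel q P rule h z * G z =
  \sum_x next_prob (q (rule h)) (P (rule h)) (arm_states h (rule h)) x *
         G (rule h, x).
Proof.
transitivity (\sum_a \sum_x history_kernel q P rule h (a, x) * G (a, x)).
  by rewrite pair_bigA; apply: eq_bigr => -[].
rewrite (bigD1 (rule h)) //= [X in _ + X]big1 ?addr0 => [|a neq].
  by apply: eq_bigr => x _; rewrite /history_kernel /= eqxx mul1r.
by apply: big1 => x _; rewrite /history_kernel /= (negPf neq) !mul0r.
Qed.

Lemma history_kernel_distr h :
  (forall a, is_distr (q a)) -> (forall a, is_stochastic (P a)) ->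
  is_distr (history_kernel q P rule h).
Proof.
move=> qP PP; split=> [z|].
  by rewrite mulr_ge0 // (next_prob_distr _ (qP _) (PP _)).1.
under eq_bigr do rewrite -[history_kernel _ _ _ _ _]mulr1.
rewrite history_kernel_sum; under eq_bigr do rewrite mulr1.
exact: (next_prob_distr _ (qP _) (PP _)).2.
Qed.

End Kernel.

(** The solution [u] of the Poisson equation for the one-step divergence, read at
    the last state of the arm; the value on the empty past is chosen so that the
    identity also holds for the initial distribution. *)
Lemma arm_potential (q q' : S -> R) (P P' : S -> S -> R) :
  is_distr q -> is_stochastic P -> irreducible P ->
  exists (psi : seq S -> R) (B : R), (forall s, `|psi s| <= B) /\
  forall s, \sum_x next_prob q P s x * ln (next_prob q P s x / next_prob q' P' s x)
            + \sum_x next_prob q P s x * psi (x :: s) = KL_rate P P' + psi s.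
Proof.
move=> qP PP Pirr.
have [x0 _] : exists x0 : S, True.
  have [//|S0] := pselect (exists x : S, True); have := qP.2.
  by rewrite big1 => [/eqP|x]; [rewrite eq_sym oner_eq0 | case: S0; exists x].
have [[pi_ge0 pi1] _] := stationaryP PP x0.
pose g x := \sum_y P x y * ln (P x y / P' x y).
have KLE : KL_rate P P' = \sum_x stationary P x * g x.
  by apply: eq_bigr => x _; rewrite mulr_sumr; apply: eq_bigr => y _; rewrite mulrA.
have [|u uP] := @poisson_equation _ _ _ PP Pirr x0 (fun x => g x - KL_rate P P').
  under eq_bigr do rewrite mulrBr.
  by rewrite sumrB -mulr_suml pi1 mul1r -KLE subrr.
pose c := \sum_x q x * ln (q x / q' x) + \sum_x q x * u x - KL_rate P P'.
exists (fun s => if s is y :: _ then u y else c), (`|c| + \sum_x `|u x|); split.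
  case=> [|y s]; first by rewrite lerDl sumr_ge0.
  by rewrite (bigD1 y) //= addrCA lerDl addr_ge0 // sumr_ge0.
case=> [|y s] /=; first by rewrite /c addrCA subrr addr0.
by rewrite -[X in X + _]/(g y); have := uP y; lra.
Qed.

(** The sum [Psi] of the potentials of the arms changes on average by
    [KL_rate (P a) (P' a)] minus the one-step divergence when arm [a] is pulled.
    Dynkin's formula then leaves only the values of [Psi] at both ends, and these
    are bounded independently of the sampling and stopping rules. *)
Lemma expected_log_ratio_le (q q' : 'I_K -> S -> R) (P P' : 'I_K -> S -> S -> R) :
  (forall a, is_distr (q a)) -> (forall a, is_stochastic (P a)) ->
  (forall a, irreducible (P a)) ->
  exists C : R, forall rule (stopped : seq ('I_K * S) -> bool) n,
  stopped_value stopped (history_kernel q P rule)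
    (step_divergence (history_kernel q P rule) (history_kernel q' P' rule))
    (fun=> 0) n [::] <=
  \sum_a KL_rate (P a) (P' a) *
    stopped_value stopped (history_kernel q P rule)
      (fun h => (rule h == a)%:R) (fun=> 0) n [::] + C.
Proof.
move=> qP PP Pirr.
have /choice [psi /choice [B psiP]] :=
  fun a => arm_potential (q' a) (P' a) (qP a) (PP a) (Pirr a).
pose D a := KL_rate (P a) (P' a).
pose Psi h := \sum_a psi a (arm_states h a).
have Psi_le h : `|Psi h| <= \sum_a B a.
  by apply: le_trans (ler_norm_sum _ _ _) _; apply: ler_sum => a _; apply: (psiP a).1.
(* The potential is at least [- \sum_a B a] when the process is halted and at
   most [\sum_a B a] at the start. *)
exists (2 * \sum_a B a) => rule stopped n; set kappa := history_kernel q P rule.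
have kP : is_kernel kappa by move=> h; apply: history_kernel_distr.
set d := step_divergence _ _.
pose c h := \sum_a D a * (rule h == a)%:R.
have cE h : c h = D (rule h).
  rewrite /c (bigD1 (rule h)) //= eqxx mulr1 big1 ?addr0 // => a.
  by rewrite eq_sym => /negPf ->; rewrite mulr0.
have := @dynkin _ _ stopped kappa (fun h => d h + -1 * c h) Psi n [::].
rewrite stopped_value_split stopped_value_lin_cost stopped_value_cost_sum => dyn.
have lower : - \sum_a B a <= stopped_value stopped kappa (fun=> 0) Psi n [::].
  rewrite -[X in X <= _](@stopped_value_cst _ _ stopped kappa _ n [::]) //.
  apply: le_stopped_value => // h.
  by have := Psi_le h; rewrite ler_norml => /andP[].
have upper : Psi [::] <= \sum_a B a by apply: le_trans (ler_norm _) (Psi_le _).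
suff step : forall h, d h + -1 * c h + \sum_z kappa h z * Psi (z :: h) = Psi h.
  by have := dyn step; lra.
move=> h; rewrite cE.
rewrite /d /step_divergence !history_kernel_sum /kappa /history_kernel /=.
under eq_bigr => x _ do rewrite eqxx !mul1r.
under [X in _ + X]eq_bigr => x _.
  rewrite /Psi (bigD1 (rule h)) //= arm_states_cons eqxx.
  under eq_bigr => a neq do rewrite arm_states_cons eq_sym (negPf neq).
  rewrite mulrDr.
  over.
have := (psiP (rule h)).2 (arm_states h (rule h)).
rewrite !big_split /= -mulr_suml (next_prob_distr _ (qP _) (PP _)).2.
rewrite /Psi [in X in _ -> _ = X](bigD1 (rule h)) //= -/(D _). lra.
Qed.

End ArmHistories.

(** * The law of the observed history *)

Section ObservedHistory.
Variables (R : realType) (S : finType) (f : S -> R) (K : nat).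
Variables (d : measure_display) (Omega : measurableType d).
Variable X : 'I_K -> nat -> Omega -> S.
Variable A : nat -> Omega -> 'I_K.
Implicit Types (h : seq ('I_K * S)) (w : Omega).

Fixpoint history t w : seq ('I_K * S) :=
  if t is r.+1 then
    (A t w, X (A t w) (size (arm_states (history r w) (A t w))) w) :: history r w
  else [::].

Lemma size_history t w : size (history t w) = t.
Proof. by elim: t => //= t ->. Qed.

Lemma history_prefix r t w w' :
  (r <= t)%N -> history t w = history t w' -> history r w = history r w'.
Proof.
elim: t => [|t IHt]; first by rewrite leqn0 => /eqP ->.
by rewrite leq_eqVlt ltnS => /predU1P [->//|rt] /= [_ _ /(IHt rt)].
Qed.

Lemma npulls_history a t w : npulls A a t w = size (arm_states (history t w) a).
Proof.
elim: t => [|t IHt]; first by rewrite /npulls big_geq.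
rewrite /npulls big_nat_recr //= -/(npulls A a t w) IHt.
by rewrite arm_states_cons; case: (A t.+1 w == a); rewrite /= ?addn1 ?addn0.
Qed.

Lemma observed_history t w w' : (1 <= t)%N ->
  history t w = history t w' -> observed f X A t w = observed f X A t w'.
Proof.
case: t => // t _; rewrite /observed !npulls_history /= !arm_states_cons !eqxx /=.
by move=> [_ -> _].
Qed.

(** The sets that do not separate [w] from [w'] form a sigma-field. *)
Lemma filtration_history t (E : set Omega) w w' :
  filtration f X A t E -> history t w = history t w' -> E w -> E w'.
Proof.
move=> FE ww'.
pose G := [set E : set Omega | E w <-> E w'].
suff : G E by move=> [+ _].
move: E FE; apply: smallest_sub.
  split=> [//|B [BB' B'B]|B BP].
    by split=> -[_ nB]; split=> // Bw; apply: nB; [exact: B'B|exact: BB'].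
  by split=> -[n _ Bn]; exists n => //; apply/(BP n).
move=> _ [r [/andP[r1 rt] [[B ->]|[B _ ->]]]]; rewrite /G /=.
  case: r r1 rt => // r _ rt; have := history_prefix rt ww'.
  by move=> /= [-> _ _].
by rewrite (observed_history r1 (history_prefix rt ww')).
Qed.

Fixpoint arm_cylinder (a : 'I_K) (s : seq S) : set Omega :=
  if s is x :: s' then [set w | X a (size s') w = x] `&` arm_cylinder a s'
  else setT.

Definition has_history h : set Omega := [set w | history (size h) w = h].

Hypothesis next_arm : forall t a, filtration f X A t [set w | A t.+1 w = a].

(** The arm pulled after the history [h]: by [filtration_history] it is the same at
    all the points of [Omega] with history [h].  The default [a0] serves the
    histories that never occur. *)
Definition sampling_rule (a0 : 'I_K) h : 'I_K :=
  xget a0 [set a | exists2 w, has_history h w & A (size h).+1 w = a].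

Variable a0 : 'I_K.
Notation rule := (sampling_rule a0).

Lemma sampling_ruleE h w : has_history h w -> A (size h).+1 w = rule h.
Proof.
move=> hw.
have [w' hw' <-] : [set a | exists2 w, has_history h w & A (size h).+1 w = a] (rule h).
  by apply: xgetPex; exists (A (size h).+1 w), w.
have FE := @next_arm (size h) (A (size h).+1 w').
by apply: (filtration_history FE) (erefl _); rewrite hw hw'.
Qed.

(** The histories in which every arm is the one that the rule prescribes after the
    preceding observations; the others have probability zero. *)
Fixpoint follows_rule h : bool :=
  if h is z :: h' then (z.1 == rule h') && follows_rule h' else true.

(** Once the states seen on each arm are given, the arms are forced by the rule:
    the history is a product of cylinders, one for each arm.  This is what allows
    the independence of the arms to be used at random numbers of pulls. *)
Lemma has_historyE h :
  has_history h =
  [set w | follows_rule h /\ forall a, arm_cylinder a (arm_states h a) w].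
Proof.
apply/seteqP; elim: h => [|[a x] h [IH1 IH2]]; first by split.
rewrite /has_history /=; split=> w /=.
  move=> [aE xE hw]; have [fh cyl] := IH1 _ hw.
  rewrite -(sampling_ruleE hw) aE eqxx fh; split=> // b.
  rewrite arm_states_cons; case: eqP => [<-|_]; last exact: cyl.
  by split; [rewrite /= -xE aE hw|exact: cyl].
move=> [/andP[/eqP aE fh] cyl].
have hw : has_history h w.
  apply: IH2; split=> // b; have := cyl b.
  by rewrite arm_states_cons; case: ifP => // _ [].
rewrite hw (sampling_ruleE hw) -aE; congr (_ :: _).
by have := cyl a; rewrite arm_states_cons eqxx => -[<-].
Qed.

Hypothesis X_measurable : forall a n x, measurable [set w | X a n w = x].

Lemma measurable_arm_cylinder a s : measurable (arm_cylinder a s).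
Proof. by elim: s => [|x s IHs] //=; apply: measurableI. Qed.

Lemma measurable_has_history h : measurable (has_history h).
Proof.
rewrite has_historyE; case: (follows_rule h); last first.
  by rewrite (_ : [set _ | _] = set0) //; apply/seteqP; split=> w [].
rewrite (_ : [set _ | _] = \bigcap_a arm_cylinder a (arm_states h a)).
  by apply: fin_bigcap_measurable => // a _; apply: measurable_arm_cylinder.
by apply/seteqP; split=> w; [move=> [_ c] a _; apply: c|move=> c; split=> // a; apply: c].
Qed.

(** An event of the filtration is a finite union of history events. *)
Lemma measurable_filtration t E : filtration f X A t E -> measurable E.
Proof.
move=> FE.
rewrite (_ : E = \bigcup_(h in [set h : t.-tuple ('I_K * S) |
    exists2 w, has_history h w & E w]) has_history h).
  apply: fin_bigcup_measurable; first exact: finite_finset.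
  by move=> h _; apply: measurable_has_history.
have self w : has_history (Tuple (introT eqP (size_history t w))) w.
  by rewrite /has_history /= size_history.
apply/seteqP; split=> w.
  by move=> Ew; exists (Tuple (introT eqP (size_history t w))) => //; exists w.
move=> [h /= [w' hw' Ew'] hw]; apply: filtration_history FE _ Ew'.
by move: hw hw'; rewrite /has_history /= size_tuple => -> ->.
Qed.

Section Law.
Variables (Pr : probability Omega R) (q : 'I_K -> S -> R) (P : 'I_K -> S -> S -> R).
Hypothesis chains : forall a, is_markov_chain Pr (X a) (q a) (P a).
Hypothesis indep : mutually_independent Pr (fun a => sigma_process (X a)).

Fixpoint path_mass (a : 'I_K) (s : seq S) : R :=
  if s is x :: s' then path_mass a s' * next_prob (q a) (P a) s' x else 1.

Lemma arm_cylinderE x0 a s :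
  arm_cylinder a s = [set w | forall i, (i < size s)%N -> X a i w = nth x0 (rev s) i].
Proof.
elim: s => [|x s IHs]; first by apply/seteqP; split.
rewrite /= IHs rev_cons; apply/seteqP; split=> w /=.
  move=> [xE sE] i; rewrite ltnS leq_eqVlt nth_rcons size_rev.
  by case: (ltngtP i (size s)) => [/sE||->].
move=> cyl; split; first by rewrite cyl ?ltnSn // nth_rcons size_rev ltnn eqxx.
by move=> i lti; rewrite cyl 1?ltnW // nth_rcons size_rev lti.
Qed.

Lemma arm_cylinder_prob a s : Pr (arm_cylinder a s) = (path_mass a s)%:E.
Proof.
elim: s => [|x [|y s] IHs]; first exact: probability_setT.
  by rewrite /= setIT mul1r (chains a).1.
rewrite (arm_cylinderE x) [RHS]/= EFinM -/(path_mass a (y :: s)) -IHs (arm_cylinderE x).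
rewrite /= !rev_cons.
have := (chains a).2 (size s) (nth x (rcons (rcons (rev s) y) x)).
rewrite !nth_rcons !size_rcons !size_rev ltnS leqnn ltnn !eqxx ltnn => chain.
rewrite [LHS]chain; congr (Pr _ * _)%E; apply/seteqP; split=> w /= cyl i lti.
  by rewrite cyl // !nth_rcons !size_rcons !size_rev lti.
by rewrite cyl // [in RHS]nth_rcons !size_rcons !size_rev ltnS lti.
Qed.

Lemma sigma_process_cylinder a s : sigma_process (X a) (arm_cylinder a s).
Proof.
elim: s => [|x s IHs]; first exact: (@measurableT _ (g_sigma_algebraType _)).
apply: (@measurableI _ (g_sigma_algebraType _)) => //.
by apply: sub_sigma_algebra; exists (size s), x.
Qed.

Lemma has_history_prob h :
  Pr (has_history h) =
  ((follows_rule h)%:R * \prod_a path_mass a (arm_states h a))%:E.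
Proof.
rewrite has_historyE; case: (follows_rule h); last first.
  by rewrite mul0r (_ : [set _ | _] = set0) ?measure0 //; apply/seteqP; split=> w [].
rewrite mul1r (_ : [set _ | _] = \bigcap_a arm_cylinder a (arm_states h a)).
  rewrite indep => [|a]; last exact: sigma_process_cylinder.
  by rewrite -prodEFin; apply: eq_bigr => a _; rewrite arm_cylinder_prob.
by apply/seteqP; split=> w; [move=> [_ c] a _; apply: c|move=> c; split=> // a; apply: c].
Qed.

(** The observed history is a Markov chain on the tree: in the product over the
    arms, one more observation only changes the factor of the arm pulled. *)
Lemma has_history_cons z h :
  Pr (has_history (z :: h)) =
  (Pr (has_history h) * (history_kernel q P rule h z)%:E)%E.
Proof.
case: z => a x; rewrite !has_history_prob -EFinM /history_kernel /=; congr EFin.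
case: eqP => [_|_]; last by rewrite !mul0r mulr0.
rewrite mul1r -mulrA; congr (_ * _).
rewrite (bigD1 a) //= [in RHS](bigD1 a) //= arm_states_cons eqxx /=.
rewrite [RHS]mulrAC; congr (_ * _); apply: eq_bigr => b.
by rewrite arm_states_cons eq_sym => /negPf ->.
Qed.

End Law.

End ObservedHistory.

(** * The expected stopping time as a sum of survival probabilities *)

Section StoppingTimes.
Variables (R : realType) (d : measure_display) (Omega : measurableType d).
Variables (Pr : probability Omega R) (tau : Omega -> option nat).
Hypothesis stopped_by_measurable : forall t, measurable (stopped_by tau t).

Lemma measurable_time_value :
  measurable_fun setT (time_value R \o tau : Omega -> \bar R).
Proof.
move=> _ B _; rewrite setTI.
have tau_measurable n : measurable [set w | tau w = n].
  case: n => [n|].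
    rewrite (_ : [set _ | _] = stopped_by tau n `\` \bigcup_(m in `I_n) stopped_by tau m).
      by apply: measurableD => //; apply: bigcup_measurable.
    apply/seteqP; split=> w /=.
      move=> tw; split; first by exists n.
      by move=> [m /= mn [r]]; rewrite tw => -[<-]; rewrite leqNgt mn.
    move=> [[r tw]]; rewrite leq_eqVlt => /predU1P [<-//|rn] []; exists r => //.
    by exists r.
  rewrite (_ : [set _ | _] = ~` \bigcup_n stopped_by tau n).
    by apply: measurableC; apply: bigcup_measurable.
  apply/seteqP; split=> w /=; first by move=> tw [n _ [r]]; rewrite tw.
  case tw : (tau w) => [n|//] []; exists n => //; by exists n.
rewrite (_ : _ @^-1` _ = \bigcup_n
    (if `[< B (time_value R n) >] then [set w | tau w = n] else set0)).
  by apply: countable_bigcupT_measurable => // n; case: ifP.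
apply/seteqP; split=> w /= => [Bw|[n _]].
  by exists (tau w) => //; rewrite asboolT.
by case: ifP => // /asboolP Bn /= ->.
Qed.

(** Pointwise, the number of times [r < n] at which [tau] has not yet occurred is
    the minimum of [tau] and [n]. *)
Lemma sum_survival_le n :
  (\sum_(r < n) Pr (~` stopped_by tau r) <= \int[Pr]_w time_value R (tau w))%E.
Proof.
have mS r : measurable (~` stopped_by tau r) by apply: measurableC.
have -> : (\sum_(r < n) Pr (~` stopped_by tau r) =
    \int[Pr]_w \sum_(r < n) (\1_(~` stopped_by tau r) w)%:E)%E.
  rewrite ge0_integral_sum //.
    by apply: eq_bigr => r _; rewrite integral_indic ?setIT.
  by move=> r; apply/measurable_EFinP; apply: measurable_indic.
apply: ge0_le_integral => //.
- by move=> w _; apply: sume_ge0.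
- by apply: emeasurable_sum => r; apply/measurable_EFinP; apply: measurable_indic.
- exact: measurable_time_value.
move=> w _; rewrite sumEFin; case tw : (tau w) => [m|]; last exact: leey.
have outside r : (w \in ~` stopped_by tau r) = (r < m)%N.
  rewrite in_setC; apply/idP/idP => [/negP|rm]; last first.
    by apply/negP => /set_mem [k]; rewrite tw => -[<-]; rewrite leqNgt rm.
  by rewrite ltnNge; apply: contra_notN => mr; apply/mem_set; exists m.
under eq_bigr do rewrite indicE outside.
rewrite lee_fin -natr_sum ler_nat.
elim: n => [|n IHn]; first by rewrite big_ord0.
rewrite big_ord_recr /=; case: ltnP => [nm|_]; last by rewrite addn0.
rewrite addn1; apply: leq_trans nm; rewrite ltnS.
rewrite -[X in (_ <= X)%N](card_ord n) -sum1_card.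
by apply: leq_sum => r _; apply: leq_b1.
Qed.
End StoppingTimes.

(** * Stopped events computed on the tree *)

Lemma measure_finite_partition (R : realType) d (T : measurableType d)
    (mu : {measure set T -> \bar R}) (I : finType) (F : I -> set T) :
  (forall i, measurable (F i)) -> trivIset setT F ->
  (mu (\bigcup_i F i) = \sum_i mu (F i))%E.
Proof.
move=> mF tF.
rewrite measure_fin_bigcup; [|exact: finite_finset|exact: tF|by move=> i _; exact: mF].
have -> : [set: I] = [set` index_enum I].
  by apply/seteqP; split=> // i _ /=; rewrite mem_index_enum.
by rewrite -fsbig_seq // index_enum_uniq.
Qed.

Section StoppedProbabilities.
Variables (R : realType) (S : finType) (f : S -> R) (K : nat).
Variables (d : measure_display) (Omega : measurableType d).
Variable X : 'I_K -> nat -> Omega -> S.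
Variable A : nat -> Omega -> 'I_K.
Variable tau : Omega -> option nat.
Hypothesis X_measurable : forall a n x, measurable [set w | X a n w = x].
Hypothesis next_arm : forall t a, filtration f X A t [set w | A t.+1 w = a].
Hypothesis tau_stopping : is_stopping_time f X A tau.
Implicit Types (h : seq ('I_K * S)) (w : Omega).

Notation has_history := (has_history X A).

Lemma stopped_by0 : stopped_by tau 0 = set0.
Proof.
apply/seteqP; split=> // w [r tw]; rewrite leqn0 => /eqP r0.
by move: tw; rewrite r0 => /tau_stopping.1.
Qed.

Lemma measurable_stopped_by (a0 : 'I_K) t : measurable (stopped_by tau t).
Proof.
case: t => [|t]; first by rewrite stopped_by0.
apply: (measurable_filtration next_arm a0 X_measurable).
exact: tau_stopping.2.
Qed.

Lemma stopped_by_history w w' t :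
  history X A t w = history X A t w' -> stopped_by tau t w -> stopped_by tau t w'.
Proof.
case: t => [|t]; first by rewrite stopped_by0.
by apply: filtration_history; apply: tau_stopping.2.
Qed.

Lemma le_stopped_by s t : (s <= t)%N -> stopped_by tau s `<=` stopped_by tau t.
Proof. by move=> st w [r tw rs]; exists r => //; apply: leq_trans st. Qed.

(** By [stopped_by_history], [tau] has occurred by the time of [h] either at all
    points with history [h] or at none of them. *)
Definition stopped h : bool :=
  `[< exists2 w, has_history h w & stopped_by tau (size h) w >].

Definition stopped_in (E : set Omega) h : bool :=
  `[< exists w, [/\ has_history h w, stopped_by tau (size h) w & E w] >].

Lemma stoppedP h w : has_history h w -> stopped h -> stopped_by tau (size h) w.
Proof.
by move=> hw /asboolP[w' hw' sw']; apply: stopped_by_history sw'; rewrite hw hw'.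
Qed.

Section Law.
Variable a0 : 'I_K.
Variables (Pr : probability Omega R) (q : 'I_K -> S -> R) (P : 'I_K -> S -> S -> R).
Hypothesis chains : forall a, is_markov_chain Pr (X a) (q a) (P a).
Hypothesis indep : mutually_independent Pr (fun a => sigma_process (X a)).

Notation kappa := (history_kernel q P (sampling_rule X A a0)).

Lemma has_history_partition h (E : set Omega) : measurable E ->
  Pr (has_history h `&` E) = (\sum_z Pr (has_history (z :: h) `&` E))%E.
Proof.
move=> mE.
rewrite -measure_finite_partition; first last.
- apply/trivIsetP => z z' _ _ /eqP zz'; apply/seteqP; split=> // w [[hw _] [hw' _]].
  by apply: zz'; move: hw hw'; rewrite /has_history /= => -> [->].
- move=> z; apply: measurableI => //.
  exact: measurable_has_history next_arm a0 X_measurable _.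
congr (Pr _); apply/seteqP; split=> w.
  move=> [hw Ew]; have := erefl (history X A (size h).+1 w).
  rewrite [RHS]/= hw; set z := (_, _) => hz.
  by exists z.
move=> [z _ [hz Ew]]; split=> //.
by move: hz; rewrite /has_history /= => -[].
Qed.

Let prob_history h : exists p : R, Pr (has_history h) = p%:E.
Proof. by eexists; apply: (has_history_prob next_arm a0 chains indep). Qed.

(** On a stopped history the event [E] is decided, and on any other history the
    event splits according to the next observation. *)
Lemma stopped_value_prob (E : set Omega) n h :
  measurable E ->
  (forall t, (1 <= t)%N -> filtration f X A t (E `&` stopped_by tau t)) ->
  Pr (has_history h `&` (E `&` stopped_by tau (size h + n))) =
  (Pr (has_history h) *
   (stopped_value stopped kappa (fun=> 0) (fun h => (stopped_in E h)%:R) n h)%:E)%E.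
Proof.
move=> mE FE.
have decided m h' : stopped h' \/ m = 0%N ->
  Pr (has_history h' `&` (E `&` stopped_by tau (size h' + m))) =
  (Pr (has_history h') * (stopped_in E h')%:R%:E)%E.
  move=> sh; have [eh|eh] := boolP (stopped_in E h').
    rewrite mule1; congr (Pr _); apply/seteqP; split=> w; first by case.
    move=> hw; split=> //; move: eh => /asboolP[w' [hw' sw' Ew']].
    have [Ew sw] : (E `&` stopped_by tau (size h')) w.
      case: h' {sh} hw hw' sw' => [|z h'] hw hw' sw'; first by rewrite stopped_by0 in sw'.
      apply: (filtration_history (FE (size (z :: h')) isT)) (conj Ew' sw').
      by rewrite hw hw'.
    by split=> //; apply: le_stopped_by sw; rewrite leq_addr.
  rewrite mule0 (_ : _ `&` _ = set0) ?measure0 //; apply/seteqP; split=> // w [hw [Ew sw]].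
  case/asboolP: eh; exists w; split=> //.
  by case: sh => [/(stoppedP hw)//|m0]; move: sw; rewrite m0 addn0.
elim: n h => [|n IHn] h; first by rewrite decided /=; [rewrite if_same|right].
have [sh|nsh] := boolP (stopped h); first by rewrite /= sh decided; [|left].
rewrite has_history_partition; last first.
  by apply: measurableI => //; exact: measurable_stopped_by a0 _.
rewrite /= (negPf nsh) add0r -sumEFin.
have [p pE] := prob_history h.
under eq_bigr => z _.
  rewrite addnS -addSn (IHn (z :: h)) (has_history_cons next_arm a0 chains indep) pE.
  rewrite -muleA -EFinM.
  over.
by rewrite pE !sumEFin -EFinM mulr_sumr.
Qed.

Lemma stopped_duration_prob n h :
  (\sum_(r < n) Pr (has_history h `&` ~` stopped_by tau (size h + r)))%E =
  (Pr (has_history h) *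
   (stopped_value stopped kappa (fun=> 1) (fun=> 0) n h)%:E)%E.
Proof.
elim: n h => [|n IHn] h; first by rewrite big_ord0 /= if_same mule0.
have [sh|nsh] := boolP (stopped h).
  rewrite /= sh mule0 big1 // => r _.
  rewrite (_ : _ `&` _ = set0) ?measure0 //; apply/seteqP; split=> // w [hw []].
  by apply: le_stopped_by (stoppedP hw sh); rewrite leq_addr.
have [p pE] := prob_history h.
rewrite big_ord_recl /= (negPf nsh) addn0 EFinD.
rewrite (_ : has_history h `&` ~` stopped_by tau (size h) = has_history h); last first.
  apply/seteqP; split=> [w []//|w hw]; split=> // sw.
  by case/asboolP: nsh; exists w.
rewrite pE -EFinD -EFinM mulrDr mulr1 EFinD; congr (_ + _)%E.
under eq_bigr => r _.
  rewrite has_history_partition; last by apply: measurableC; exact: measurable_stopped_by a0 _.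
  over.
rewrite exchange_big /=.
under eq_bigr => z _.
  under eq_bigr => r _ do rewrite /bump /= add1n addnS -addSn.
  rewrite (IHn (z :: h)) (has_history_cons next_arm a0 chains indep) pE.
  rewrite -muleA -EFinM.
  over.
by rewrite sumEFin mulr_sumr.
Qed.

Lemma has_history_nil : has_history [::] = setT.
Proof. by apply/seteqP; split. Qed.

Lemma stopped_prob (E : set Omega) n : measurable E ->
  (forall t, (1 <= t)%N -> filtration f X A t (E `&` stopped_by tau t)) ->
  Pr (E `&` stopped_by tau n) =
  (stopped_value stopped kappa (fun=> 0) (fun h => (stopped_in E h)%:R) n [::])%:E.
Proof.
move=> mE FE; have := stopped_value_prob n [::] mE FE.
by rewrite has_history_nil setTI probability_setT mul1e.
Qed.

Lemma stopped_duration n :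
  (\sum_(r < n) Pr (~` stopped_by tau r))%E =
  (stopped_value stopped kappa (fun=> 1) (fun=> 0) n [::])%:E.
Proof.
have := stopped_duration_prob n [::].
rewrite has_history_nil probability_setT mul1e => <-.
by apply: eq_bigr => r _; rewrite setTI.
Qed.

End Law.
End StoppedProbabilities.

(** * The information inequality at a fixed confidence level *)

Section FiniteHorizon.
Variables (R : realType) (S : finType) (f : S -> R).
Variables (Theta : set R) (q : R -> S -> R) (P : R -> S -> S -> R).
Hypothesis q_distr : forall t, Theta t -> is_distr (q t).
Hypothesis P_stochastic : forall t, Theta t -> is_stochastic (P t).
Hypothesis P_irreducible : forall t, Theta t -> irreducible (P t).
Hypothesis P_support : forall t l, Theta t -> Theta l ->
  forall x y, 0 < P t x y -> 0 < P l x y.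
Hypothesis q_support : forall t l, Theta t -> Theta l ->
  forall x, 0 < q t x -> 0 < q l x.
Variables (K : nat) (d : measure_display) (Omega : measurableType d).
Variable X : 'I_K -> nat -> Omega -> S.
Hypothesis X_measurable : forall a n x, measurable [set w | X a n w = x].
Variable Pr : ('I_K -> R) -> probability Omega R.
Hypothesis X_law : forall l : 'I_K -> R, (forall a, Theta (l a)) ->
  bandit_law (Pr l) X q P l.

Lemma history_kernel_support (t l : 'I_K -> R) rule h z :
  (forall a, Theta (t a)) -> (forall a, Theta (l a)) ->
  (0 < history_kernel (q \o t) (P \o t) rule h z) =
  (0 < history_kernel (q \o l) (P \o l) rule h z).
Proof.
move=> tT lT; rewrite /history_kernel; case: (z.1 == _); last by rewrite !mul0r.
rewrite !mul1r; case: (arm_states _ _) => [|y s] /=.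
  by apply/idP/idP; apply: q_support.
by apply/idP/idP; apply: P_support.
Qed.

Lemma decision_event (s : strategy K Omega) (o : option 'I_K) :
  sampling_strategy f Theta P X Pr s ->
  stopped_sigma f X (arm s) (stop s) [set w | Some (decision s w) = o].
Proof.
move=> [_ _ _ dec]; case: o => [b|].
  rewrite (_ : [set _ | _] = [set w | decision s w = b]); first exact: dec.
  by apply/seteqP; split=> w /= => [[->]|->].
rewrite (_ : [set _ | _] = set0); last by apply/seteqP; split=> w.
split; first exact: measurable0.
by move=> t _; rewrite set0I; apply: (@measurable0 _ (g_sigma_algebraType _)).
Qed.

(** [T] is the expectation of [tau /\ n] and [w] the expected proportion of pulls
    of each arm up to that time.  The horizon [n] depends on [delta] and on the
    strategy, but the constant [C] does not. *)
Lemma finite_horizon_bound (theta : 'I_K -> R) :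
  bold_Theta f Theta P theta ->
  exists C : ('I_K -> R) -> R, forall (delta : R) (s : strategy K Omega),
    0 < delta < 1 -> sampling_strategy f Theta P X Pr s ->
    delta_PC f Theta P Pr delta s ->
  exists (w : 'I_K -> R) (T : R),
    [/\ is_distr w, 0 < T, (T%:E <= expected_time Pr theta s)%E &
      forall l, Alt f Theta P theta l ->
        (1 - 2 * delta) * ln (1 / delta) - C l <=
        (\sum_a w a * KL_rate (P (theta a)) (P (l a))) * T].
Proof.
move=> theta_bold; have [theta_Theta best1] := theta_bold.
have [a0 _] : exists a0 : 'I_K, True.
  have /card_gt0P[a0 _] : (0 < #|[pred a | is_best f P theta a]|)%N by rewrite best1.
  by exists a0.
have qt a : is_distr ((q \o theta) a) by apply: q_distr.
have Pt a : is_stochastic ((P \o theta) a) by apply: P_stochastic.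
have irrt a : irreducible ((P \o theta) a) by apply: P_irreducible.
have /choice[C CP] := fun l : 'I_K -> R =>
  expected_log_ratio_le (q \o l) (P \o l) qt Pt irrt.
exists (fun l => ln 2 + C l) => delta s /andP[delta0 delta1] str pc.
have [next_arm stopping finite_time _] := str.
set tau := stop s in stopping.
set rule := sampling_rule X (arm s) a0.
pose kappa (l : 'I_K -> R) := history_kernel (q \o l) (P \o l) rule.
pose stp := stopped X (arm s) tau.
have kernelP l : (forall a, Theta (l a)) -> is_kernel (kappa l).
  move=> lT h; apply: history_kernel_distr => a; [exact: q_distr|exact: P_stochastic].
have mS t : measurable (stopped_by tau t).
  exact: measurable_stopped_by X_measurable next_arm stopping a0 t.
have time_ge0 : (0 <= expected_time Pr theta s)%E.
  by apply: integral_ge0 => w _; case: (stop s w) => [n|] //=; rewrite lee_fin.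
have [e eE] : exists e : R, expected_time Pr theta s = e%:E.
  exists (fine (expected_time Pr theta s)); rewrite fineK // ge0_fin_numE //.
  exact: finite_time.
(* By Markov's inequality this horizon is exceeded with probability [delta] at
   most. *)
have [n en] : exists n, e < delta * n.+1%:R.
  exists (Num.truncn (e / delta)).
  by rewrite mulrC -ltr_pdivrMr // truncnS_gt.
pose value l c g := stopped_value stp (kappa l) c g n.+1 [::].
have duration : (\sum_(r < n.+1) Pr theta (~` stopped_by tau r))%E =
    (value theta (fun=> 1) (fun=> 0))%:E.
  have [chains indep] := X_law theta_Theta.
  exact: (stopped_duration X_measurable next_arm stopping a0 chains indep).
set T := value theta _ _ in duration.
have T_le : (T%:E <= expected_time Pr theta s)%E.
  by rewrite -duration; apply: sum_survival_le.
have T_gt0 : 0 < T.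
  rewrite /T /value /=; case: ifP => [/asboolP[w _]|_].
    by rewrite (stopped_by0 stopping).
  rewrite ltr_wpDr // sumr_ge0 // => z _.
  rewrite mulr_ge0 ?(kernelP _ theta_Theta _).1 //.
  by apply: stopped_value_ge0 => //; apply: kernelP.
have late : (Pr theta (~` stopped_by tau n.+1) <= delta%:E)%E.
  have [p pE] : exists p : R, Pr theta (~` stopped_by tau n.+1) = p%:E.
    by eexists; apply/esym; apply: fineK; apply: fin_num_measure; apply: measurableC.
  have : (\sum_(r < n.+1) p%:E <= T%:E)%E.
    rewrite -duration; apply: lee_sum => r _; rewrite -pE.
    apply: le_measure; rewrite ?inE; [exact: measurableC..|].
    by apply: subsetC; apply: le_stopped_by; apply: ltnW.
  rewrite sumEFin sumr_const card_ord lee_fin pE => pT.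
  have {}pT : p *+ n.+1 < delta * n.+1%:R.
    apply: le_lt_trans pT _; apply: le_lt_trans en.
    by rewrite -lee_fin -eE.
  by rewrite lee_fin ltW // -(ltr_pM2r (ltr0Sn R n)) mulr_natr.
pose E := [set w | Some (decision s w) = best_arm f P theta].
have [mE FE] := decision_event (best_arm f P theta) str.
rewrite -/E in mE FE.
pose e_in h : R := (stopped_in X (arm s) tau E h)%:R.
have prob l : (forall a, Theta (l a)) ->
    Pr l (E `&` stopped_by tau n.+1) = (value l (fun=> 0) e_in)%:E.
  move=> lT; have [chains indep] := X_law lT.
  exact: (stopped_prob X_measurable next_arm stopping a0 chains indep).
have prob_theta : 1 - 2 * delta <= value theta (fun=> 0) e_in.
  have : (Pr theta (~` (E `&` stopped_by tau n.+1)) <= delta%:E + delta%:E)%E.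
    rewrite setCI; apply: (le_trans (measureU2 _ (measurableC mE) (measurableC (mS _)))).
    apply: leeD => //; have := pc _ theta_bold; congr (_ <= _)%E.
  rewrite probability_setC; last exact: measurableI.
  by rewrite prob // -!EFinD lee_fin; lra.
pose pulls a := value theta (fun h => (rule h == a)%:R) (fun=> 0).
have pulls_ge0 a : 0 <= pulls a by apply: stopped_value_ge0 => //; apply: kernelP.
have pulls_sum : \sum_a pulls a = T.
  rewrite /T /value (_ : (fun=> 1) = fun h => \sum_a 1 * (rule h == a)%:R).
    by rewrite stopped_value_cost_sum; apply: eq_bigr => a _; rewrite mul1r.
  apply/funext => h; rewrite (bigD1 (rule h)) //= eqxx mulr1 big1 ?addr0 // => a.
  by rewrite eq_sym => /negPf ->; rewrite mulr0.
exists (fun a => pulls a / T), T; split=> //.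
  split=> [a|]; first by rewrite divr_ge0 // ltW.
  by rewrite -mulr_suml pulls_sum divff // gt_eqF.
move=> l [l_bold l_best]; have l_Theta := l_bold.1.
have ln_ge0 : 0 <= ln (1 / delta) by rewrite ln_ge0 // div1r invf_ge1 // ltW.
have prob_l : expR (ln (1 / delta)) * value l (fun=> 0) e_in <= 1.
  rewrite lnK ?posrE ?divr_gt0 // div1r mulrC ler_pdivrMr // mul1r -lee_fin -prob //.
  apply: le_trans (pc _ l_bold).
  apply: le_measure; rewrite ?inE; first exact: measurableI.
    rewrite (_ : [set _ | _] = ~` [set w | Some (decision s w) = best_arm f P l]) //.
    by apply: measurableC; apply: (decision_event _ str).1.
  by move=> w [/= -> _] bb; apply: l_best.
have := stopped_entropy_bound (kernelP _ theta_Theta) (kernelP _ l_Theta)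
  (fun h z => history_kernel_support rule h z theta_Theta l_Theta) ln_ge0 prob_l.
rewrite -/(value theta (fun=> 0) e_in).
have := CP l rule stp n.+1; rewrite -/(kappa theta) -/(kappa l).
set D := stopped_value _ _ (step_divergence _ _) _ _ _.
rewrite (_ : \sum_a _ = (\sum_a pulls a / T * KL_rate (P (theta a)) (P (l a))) * T).
  have : (1 - 2 * delta) * ln (1 / delta) <= ln (1 / delta) * value theta (fun=> 0) e_in.
    by rewrite mulrC ler_wpM2l.
  lra.
rewrite mulr_suml; apply: eq_bigr => a _.
by rewrite mulrAC divfK ?gt_eqF // mulrC.
Qed.

End FiniteHorizon.

(** * Limits of allocations and of confidence levels *)

Section LimitOfAllocations.
Variables (R : realType) (K : nat).

Lemma ge_of_cluster (v : nat -> 'rV[R]_K) (D : 'I_K -> R) (r : R) (u : 'rV[R]_K) :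
  (exists N, forall k, (N <= k)%N -> r <= \sum_a D a * v k 0 a) ->
  cluster (v @ \oo) u -> r <= \sum_a D a * u 0 a.
Proof.
move=> [N vN]; rewrite clusterE => /(_ [set x | r <= \sum_a D a * x 0 a]).
have cont : continuous (fun x : 'rV[R]_K => \sum_a D a * x 0 a).
  apply: (@continuous_big R^o _ _ _ _ _ _ _ (fun a (x : 'rV[R]_K) => D a * x 0 a)) => [|a _ x].
    exact: (@add_continuous R^o).
  apply: (@continuous_comp _ _ _ (fun x : 'rV[R]_K => x 0 a) ( *%R (D a))).
    exact: coord_continuous.
  exact: mulrl_continuous.
have clos := (continuous_closedP _).1 cont _ (@closed_ge R r).
move=> cl; apply: clos; apply: cl.
by exists N => // k /= Nk; apply: vN.
Qed.

(** Compactness of the simplex.  A cluster point is enough, because all the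
    conditions to be kept are closed half-spaces. *)
Lemma limit_allocation (w : nat -> 'I_K -> R) : (forall k, is_distr (w k)) ->
  exists2 w0 : 'I_K -> R, is_distr w0 &
    forall (D : 'I_K -> R) (r : R),
      (exists N, forall k, (N <= k)%N -> r <= \sum_a w k a * D a) ->
      r <= \sum_a w0 a * D a.
Proof.
move=> wP; pose v k : 'rV[R]_K := \row_a w k a.
have : (v @ \oo) [set x : 'rV[R]_K | forall a, `[0, 1]%classic (x ord0 a)].
  exists 0%N => // k _ a /=; rewrite mxE in_itv /= (wP k).1 /=.
  by rewrite -(wP k).2 (bigD1 a) //= lerDl sumr_ge0 // => b _; rewrite (wP k).1.
move=> /(rV_compact (fun=> @segment_compact R 0 1)) [u [_ uv]].
have lim (D : 'I_K -> R) r :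
    (exists N, forall k, (N <= k)%N -> r <= \sum_a w k a * D a) ->
    r <= \sum_a u 0 a * D a.
  move=> [N wN]; under eq_bigr do rewrite mulrC.
  apply: (ge_of_cluster _ uv); exists N => k /wN.
  by under eq_bigr do rewrite mulrC; under [X in _ -> _ <= X]eq_bigr do rewrite mxE.
exists (fun a => u 0 a) => //; split=> [a|].
  have pick (x : 'I_K -> R) : \sum_b x b * (b == a)%:R = x a.
    by rewrite (bigD1 a) //= eqxx mulr1 big1 ?addr0 // => b /negPf ->; rewrite mulr0.
  by rewrite -pick; apply: lim; exists 0%N => k _; rewrite pick (wP k).1.
apply/eqP; rewrite eq_le; apply/andP; split.
  rewrite -lerN2 -sumrN; under eq_bigr do rewrite -mulrN1.
  by apply: lim; exists 0%N => k _; rewrite -mulr_suml (wP k).2 mul1r.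
under eq_bigr do rewrite -[u _ _]mulr1.
by apply: lim; exists 0%N => k _; rewrite -mulr_suml (wP k).2 mul1r.
Qed.

End LimitOfAllocations.

Lemma ereal_between (R : realType) (x y : \bar R) :
  (x < y)%E -> exists c : R, (x < c%:E < y)%E.
Proof.
case: x => [x||]; case: y => [y||] //=.
- by rewrite lte_fin => xy; exists ((x + y) / 2); rewrite !lte_fin !midf_lt.
- by move=> _; exists (x + 1); rewrite ltry lte_fin ltrDl ltr01.
- by move=> _; exists (y - 1); rewrite ltNyr lte_fin ltrBlDr ltrDl ltr01.
- by move=> _; exists 0; rewrite ltry ltNyr.
Qed.

Lemma lt_limf_einf_right (R : realType) (F : R -> \bar R) (c : \bar R) :
  (limf_einf F (0 : R)^'+ < c)%E ->
  forall e, 0 < e -> exists2 delta, 0 < delta < e & (F delta < c)%E.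
Proof.
rewrite limf_einfE => Fc e e0.
pose V : set R := [set x | 0 < x < e].
have V0 : (0 : R)^'+ V.
  near=> x; rewrite /V /=; apply/andP; split; near: x.
    exact: nbhs_right_gt.
  exact: nbhs_right_lt.
have : (ereal_inf (F @` V) < c)%E.
  by apply: le_lt_trans Fc; apply: ereal_sup_ubound; exists V.
by move=> /ereal_inf_lt [_ [x Vx <-] xc]; exists x.
Unshelve. all: by end_near.
Qed.

(** * The lower bound *)

(** For small [delta] the constant [C] is negligible before [ln (1 / delta)]; the
    left side of the last hypothesis is then positive, so [V k] is positive and
    [T k] may be replaced by its upper bound. *)
Lemma eventually_divergence_ge (R : realType) (c C eps : R) (delta T V : nat -> R) :
  0 < eps < 1 ->
  (forall k, 0 < delta k < k.+2%:R^-1) ->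
  (forall k, 0 < T k < c * ln (1 / delta k)) ->
  (forall k, (1 - 2 * delta k) * ln (1 / delta k) - C <= V k * T k) ->
  exists N, forall k, (N <= k)%N -> (1 - eps) / c <= V k.
Proof.
move=> /andP[eps0 eps1] deltaP TP VP.
(* Half of [eps] is spent on the factor [1 - 2 * delta], half on [C]. *)
pose m := Num.min (eps / 4) (expR (- (2 * `|C| / eps))).
have m0 : 0 < m by rewrite lt_min divr_gt0 ?expR_gt0.
exists (Num.truncn m^-1) => k Nk.
have /andP[d0 dk] := deltaP k; have /andP[T0 Tk] := TP k.
have dm : delta k < m.
  apply: lt_le_trans dk _; rewrite -[leRHS]invrK lef_pV2 ?posrE ?invr_gt0 //.
  apply: ltW; apply: lt_le_trans (truncnS_gt _) _.
  by rewrite ler_nat ltnW // !ltnS.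
have d_eps : delta k < eps / 4 by move: dm; rewrite lt_min => /andP[].
set L := ln (1 / delta k) in Tk *.
have L_large : 2 * `|C| / eps <= L.
  rewrite /L div1r lnV ?posrE // lerNr -ler_expR lnK ?posrE // ltW //.
  by move: dm; rewrite lt_min => /andP[].
have L0 : 0 < L.
  by rewrite /L ln_gt0 // div1r invf_gt1 //; apply: lt_trans d_eps _; lra.
have c0 : 0 < c by rewrite -(pmulr_lgt0 _ L0); apply: lt_trans Tk.
have C_small : C <= eps / 2 * L.
  by move: L_large; rewrite ler_pdivrMr //; have := ler_norm C; lra.
have low : (1 - eps) * L <= V k * T k.
  apply: le_trans (VP k); rewrite -/L.
  have : delta k * L <= eps / 4 * L by rewrite ler_pM2r // ltW.
  lra.
have V0 : 0 < V k.
  by rewrite -(pmulr_lgt0 _ T0); apply: lt_le_trans low; rewrite mulr_gt0 // subr_gt0.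
rewrite ler_pdivrMr // -(ler_pM2r L0) -mulrA; apply: le_trans low _.
by rewrite ler_pM2l // ltW.
Qed.

Theorem theorem1 (R : realType) (S : finType) (f : S -> R)
  (f_nonconstant : exists x y, f x <> f y)
  (Theta : set R) (q : R -> S -> R) (P : R -> S -> S -> R)
  (q_distr : forall t, Theta t -> is_distr (q t))
  (P_stochastic : forall t, Theta t -> is_stochastic (P t))
  (P_irreducible : forall t, Theta t -> irreducible (P t))
  (P_support : forall t l, Theta t -> Theta l ->
     forall x y, 0 < P t x y -> 0 < P l x y)
  (q_support : forall t l, Theta t -> Theta l ->
     forall x, 0 < q t x -> 0 < q l x)
  (K : nat) (d : measure_display) (Omega : measurableType d)
  (X : 'I_K -> nat -> Omega -> S)
  (X_measurable : forall a n x, measurable [set w | X a n w = x])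
  (Pr : ('I_K -> R) -> probability Omega R)
  (X_law : forall l : 'I_K -> R, (forall a, Theta (l a)) ->
     bandit_law (Pr l) X q P l)
  (theta : 'I_K -> R) (theta_bold : bold_Theta f Theta P theta)
  (A : R -> strategy K Omega)
  (A_strategy : forall delta, 0 < delta < 1 ->
     sampling_strategy f Theta P X Pr (A delta) /\
     delta_PC f Theta P Pr delta (A delta)) :
  (characteristic_time f Theta P theta <=
   limf_einf (fun delta : R =>
     expected_time Pr theta (A delta) / (ln (1 / delta)%R)%:E) (0 : R)^'+)%E.
Proof.
rewrite leNgt; apply/negP => /ereal_between [c /andP[lim_c c_time]].
have [C bound] := finite_horizon_bound q_distr P_stochastic P_irreducible
  P_support q_support X_measurable X_law theta_bold.
have /choice[delta /choice[w /choice[T seqP]]] : forall k : nat,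
  exists (delta : R) (w : 'I_K -> R) (T : R),
  [/\ is_distr w, 0 < delta < k.+2%:R^-1, 0 < T < c * ln (1 / delta) &
    forall l, Alt f Theta P theta l ->
      (1 - 2 * delta) * ln (1 / delta) - C l <=
      (\sum_a w a * KL_rate (P (theta a)) (P (l a))) * T].
  move=> k; have k_gt0 : (0 : R) < k.+2%:R^-1 by rewrite invr_gt0 ltr0n.
  have [delta delta_k lt_c] := lt_limf_einf_right lim_c k_gt0.
  have /andP[delta_gt0 delta_lt] := delta_k.
  have delta_lt1 : delta < 1.
    by apply: lt_le_trans delta_lt _; rewrite invf_le1 ?ltr0n // ler1n.
  have delta01 : 0 < delta < 1 by apply/andP.
  have [str pc] := A_strategy _ delta01.
  have [w [T [wP T_gt0 T_le KL_ge]]] := bound _ _ delta01 str pc.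
  have ln_gt0 : 0 < ln (1 / delta) by rewrite ln_gt0 // div1r invf_gt1.
  exists delta, w, T; split=> //; rewrite T_gt0 /=.
  move: lt_c; rewrite inver gt_eqF // lte_pdivrMr // -EFinM => lt_c.
  by rewrite -lte_fin; apply: le_lt_trans lt_c.
have w_distr k : is_distr (w k) by have [] := seqP k.
have c_gt0 : 0 < c.
  have [_ /andP[d0 d1] /andP[T0 Tc] _] := seqP 0%N.
  have L0 : 0 < ln (1 / delta 0%N).
    by rewrite ln_gt0 // div1r invf_gt1 // (lt_trans d1) // invf_lt1 ?ltr0n // ltr1n.
  by rewrite -(pmulr_lgt0 _ L0); apply: lt_trans Tc.
have [w0 w0_distr w0_ge] := limit_allocation w_distr.
have rate_ge l : Alt f Theta P theta l ->
    c^-1 <= \sum_a w0 a * KL_rate (P (theta a)) (P (l a)).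
  move=> l_alt; set D := \sum_a _.
  have eps_bound eps : 0 < eps < 1 -> 1 - eps <= D * c.
    move=> epsP; rewrite -ler_pdivrMr //; apply: w0_ge.
    apply: (eventually_divergence_ge (delta := delta) (T := T) (C := C l) epsP) => k.
    - by have [] := seqP k.
    - by have [] := seqP k.
    - by have [_ _ _] := seqP k; apply.
  rewrite -[c^-1]mul1r ler_pdivrMr // leNgt; apply/negP => Dc1.
  have D2 := eps_bound 2^-1 ltac:(lra).
  by have := eps_bound ((1 - D * c) / 2) ltac:(lra); lra.
move: c_time; rewrite ltNge => /negP; apply; rewrite /characteristic_time.
set s := ereal_sup _.
have s_ge : ((c^-1)%:E <= s)%E.
  apply: (@le_trans _ _ (ereal_inf [set
      (\sum_a w0 a * KL_rate (P (theta a)) (P (l a)))%R%:E | l in Alt f Theta P theta])).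
    by apply: le_ereal_inf_tmp => _ [l l_alt <-]; rewrite lee_fin; apply: rate_ge.
  by apply: ereal_sup_ubound; exists w0.
have s_ge0 : (0 <= s)%E.
  by apply: le_trans s_ge; rewrite lee_fin invr_ge0 ltW.
rewrite inve_ple ?inE //; first by rewrite inver gt_eqF.
by rewrite lee_fin ltW.
Qed.
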